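(* Let $\sigma=\sigma_1\cdots\sigma_m$ be a permutation with $r$ descents and $\pi=\pi_1\cdots\pi_n$ a permutation with $s$ descents, with no letters in common, and let $\alpha$ be a shuffle of $\sigma$ and $\pi$ with exactly $k$ descents. Let $(\lambda,\mu)=\Phi(\alpha)$ be defined as below. Then $\lambda\in P_{k-r}(k-s,m)$ and $\mu\in P_{\le n-k+r}(k-s)$, and \[{\rm maj}(\alpha)=|\lambda|+|\mu|+{\rm maj}(\sigma)+{\rm maj}(\pi).\]
   Context: A permutation of length $n$ is a sequence of $n$ distinct letters from a totally ordered set. An index $i$ is a descent of $\pi$ if $1\le i\le n-1$ and $\pi_i>\pi_{i+1}$; ${\rm des}(\pi)$ is the number of descents and ${\rm maj}(\pi)$ the sum of the descents; $d_i(\pi)$ denotes the number of descents of $\pi$ that are $\ge i$. A shuffle of disjoint $\sigma,\pi$ is a permutation of length $m+n$ containing both as subsequences. Definition of $\Phi$: for $0\le i\le n$ let $\alpha^{(i)}$ be the permutation obtained from $\alpha$ by deleting $\pi_1,\dots,\pi_i$ (so $\alpha^{(0)}=\alpha$, $\alpha^{(n)}=\sigma$). For $1\le i\le n$ set $t(i)={\rm maj}(\alpha^{(i-1)})-{\rm maj}(\alpha^{(i)})-d_i(\pi)$. Let $i_1<\cdots<i_{k-r}$ be the indices $i\in\{1,\dots,n\}$ with ${\rm des}(\alpha^{(i-1)})={\rm des}(\alpha^{(i)})+1$ (there are exactly $k-r$ of them), and let $j_1<\cdots<j_{n-k+r}$ be the remaining indices in $\{1,\dots,n\}$ (for which ${\rm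 des}(\alpha^{(j-1)})={\rm des}(\alpha^{(j)})$). Then $\lambda=(t(i_{k-r}),t(i_{k-r-1}),\ldots,t(i_1))$ and $\mu=(t(j_1),t(j_2),\ldots,t(j_{n-k+r}))$. For integers $j,t,N$: $P_j(t,N)$ is the set of nonincreasing integer sequences of length exactly $j$ with all entries in $[t,N]$; $P_{\le j}(N)$ is the set of partitions with at most $j$ parts and largest part at most $N$ (equivalently, nonincreasing sequences of length $j$ with entries in $\{0,\dots,N\}$; here $\mu$ is identified with such a sequence). $|\cdot|$ denotes the sum of entries. *)

(* Defs.v *)
From HB Require Import structures.
From mathcomp Require Export all_boot all_order all_algebra.
Set Implicit Arguments.
Unset Strict Implicit.
Unset Printing Implicit Defensive.
Import Order.TTheory GRing.Theory Num.Theory.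

Local Open Scope ring_scope.

Section Descents.
Context {d : Order.disp_t} {T : orderType d}.
Implicit Types (w p a : seq T) (i : nat).

(* Positions are numbered from 1, so w_i is [nth x0 w i.-1]; the default value
   x0 is never reached. *)
Definition is_descent w i : bool :=
  if w is x0 :: _ then
    (1 <= i < size w)%N && (nth x0 w i < nth x0 w i.-1)%O
  else false.

Definition descents w : seq nat := [seq i <- iota 1 (size w).-1 | is_descent w i].

Definition des w : nat := size (descents w).

Definition maj w : nat := (\sum_(i <- descents w) i)%N.

Definition des_from i w : nat := count (fun j => i <= j)%N (descents w).

Definition is_shuffle w p a : bool :=
  [&& uniq a, size a == (size w + size p)%N, subseq w a & subseq p a].

(* The word alpha^(i). *)
Definition del_prefix p a i : seq T := [seq x <- a | x \notin take i p].

Definition Phi_t p a i : int :=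
  (maj (del_prefix p a i.-1))%:Z - (maj (del_prefix p a i))%:Z
  - (des_from i p)%:Z.

Definition drops_des p a i : bool :=
  des (del_prefix p a i.-1) == (des (del_prefix p a i)).+1.

Definition Phi p a : seq int * seq int :=
  let I := [seq i <- iota 1 (size p) | drops_des p a i] in
  let J := [seq i <- iota 1 (size p) | ~~ drops_des p a i] in
  ([seq Phi_t p a i | i <- rev I], [seq Phi_t p a j | j <- J]).

End Descents.

(* P_j(t, N) *)
Definition Pseq (j t N : int) : {pred seq int} :=
  [pred s | [&& (size s)%:Z == j, sorted >=%R s & all (fun x => t <= x <= N) s]].

(* P_{<= j}(N), each partition being padded with zeros to length exactly j. *)
Definition Pseq_le (j N : int) : {pred seq int} :=
  [pred s | [&& (size s)%:Z == j, sorted >=%R s & all (fun x => 0 <= x <= N) s]].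

(* Main.v *)
Require Import Defs.
From mathcomp Require Import all_boot all_order all_algebra.
From mathcomp Require Import zify.
Set Implicit Arguments.
Unset Strict Implicit.
Unset Printing Implicit Defensive.
Import Order.TTheory GRing.Theory Num.Theory.
Local Open Scope ring_scope.

(** Inserting a letter x between u and v raises des by some e in {0, 1} and maj
    by des (x v) + e |u|.  Hence t(i) = f_i + e_i p_i, where p_i is the number
    of letters of sigma before pi_i and f_i is des of the suffix of alpha
    starting at pi_i minus des of the suffix of pi starting at pi_i.  As
    inserting a word of length l raises des by an amount between 0 and l, f_i is
    nonincreasing and f_i + p_i is nondecreasing in i; thus mu is nonincreasing,
    and so is lambda, whose entries are listed backwards.  The extreme values of
    f_i and f_i + p_i bound the entries.  The lengths and the value of maj alpha
    come from telescoping des and maj along alpha^(0), ..., alpha^(n), since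
    maj pi is the sum of the d_i(pi). *)

Section IotaFilter.
Variables (U : Type) (f : nat -> U) (P : pred nat) (n : nat).

Lemma all_map_filter_iota (Q : pred U) :
    (forall i, (i < n)%N -> P i.+1 -> Q (f i.+1)) ->
  all Q [seq f i | i <- iota 1 n & P i].
Proof.
move=> Q_f; rewrite all_map; apply/allP => -[|i]; rewrite mem_filter mem_iota.
  by rewrite andbF.
by case/andP=> Pi; rewrite add1n => ltin; apply: Q_f.
Qed.

Lemma sorted_map_filter_iota (R : rel U) :
    (forall i j, (i <= j < n)%N -> P i.+1 -> P j.+1 -> R (f i.+1) (f j.+1)) ->
  sorted R [seq f i | i <- iota 1 n & P i].
Proof.
move=> R_f; pose inP := [pred i | (0 < i <= n)%N & P i].
apply: (homo_sorted_in (P := inP) (e := leq)).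
- move=> [|i] [|j] //= /andP[_ Pi] /andP[lejn Pj] le_ij.
  by apply: R_f => //; apply/andP.
- by apply/allP => i; rewrite mem_filter mem_iota add1n ltnS andbC.
exact: (sorted_filter leq_trans _ (iota_sorted _ _)).
Qed.

End IotaFilter.

Section DescentCalculus.
Context {d : Order.disp_t} {T : orderType d}.
Implicit Types (x y : T) (u v w : seq T) (i : nat).

Definition head_descent x w : bool := if w is y :: _ then (y < x)%O else false.

Lemma descents_cons x w :
  descents (x :: w) = nseq (head_descent x w) 1%N ++ map succn (descents w).
Proof.
case: w => [//|y w].
rewrite /descents /= -/(iota 2 (size w)) (iotaDl 1 1) filter_map.
have descentS : {in iota 1 (size w), forall i,
    is_descent [:: x, y & w] (1 + i) = is_descent (y :: w) i}.
  move=> [|i]; rewrite mem_iota // => /andP[_ lti] /=.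
  by rewrite !ltnS (set_nth_default y) ?(set_nth_default y x) //=; lia.
by rewrite (eq_in_filter descentS) /is_descent /=; case: (y < x)%O.
Qed.

Lemma des_cons x w : des (x :: w) = (head_descent x w + des w)%N.
Proof. by rewrite /des descents_cons size_cat size_nseq size_map. Qed.

Lemma maj_cons x w : maj (x :: w) = (maj w + des (x :: w))%N.
Proof.
have sumS s : (\sum_(i <- s) i.+1 = \sum_(i <- s) i + size s)%N.
  by rewrite -sum1_size -big_split; apply: eq_bigr => i _; rewrite -addn1.
rewrite /maj des_cons descents_cons big_cat big_map sumS big_nseq iter_addn_0.
by rewrite mul1n addnCA.
Qed.

Lemma des_cat_cons u x v :
  des (u ++ x :: v) = (des (rcons u x) + des (x :: v))%N.
Proof.
elim: u => [|y u IHu] /=; first by rewrite [in RHS]des_cons.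
by rewrite !(des_cons y) IHu -addnA; case: u {IHu}.
Qed.

Lemma maj_cat_cons u x v :
  maj (u ++ x :: v) =
  (maj (rcons u x) + maj (x :: v) + size u * des (x :: v))%N.
Proof.
elim: u => [|y u IHu] /=; first by rewrite [maj [:: x]]big_nil addn0.
by rewrite !(maj_cons y) IHu -!cat_cons des_cat_cons rcons_cons; lia.
Qed.

(* A descent y > z is still seen when x is put between y and z: either y > x or
   x > z. *)
Lemma head_descent_insert y x v :
  (head_descent y v <= (x < y)%O + head_descent x v <= (head_descent y v).+1)%N.
Proof.
case: v => [|z v] /=; first by case: (x < y)%O.
case: (ltP x y) => [xy|yx]; case: (ltP z x) => [zx|xz] //=.
- by rewrite (lt_trans zx xy).
- by case: (z < y)%O.
- by case: (z < y)%O.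
- by rewrite ltNge (le_trans yx xz).
Qed.

Lemma des_insert u x v :
  (des (u ++ v) <= des (u ++ x :: v) <= (des (u ++ v)).+1)%N.
Proof.
case/lastP: u => [|u y]; first by rewrite /= des_cons; case: head_descent; lia.
rewrite !cat_rcons !(des_cat_cons u y) !des_cons /=.
by have := head_descent_insert y x v; lia.
Qed.

Lemma maj_insert u x v :
  maj (u ++ x :: v) =
  (maj (u ++ v) + des (x :: v) + (des (u ++ x :: v) - des (u ++ v)) * size u)%N.
Proof.
case/lastP: u => [|u y]; first by rewrite /= maj_cons muln0 addn0.
have := des_insert [:: y] x v; rewrite /= => /andP[/subnKC desE _].
rewrite !cat_rcons size_rcons !(des_cat_cons u y) !(maj_cat_cons u y).
rewrite !(maj_cons y) (maj_cons x) subnDl -desE addKn.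
by rewrite mulnDr mulnS; lia.
Qed.

Lemma des_insert_word u v w :
  (des (u ++ w) <= des (u ++ v ++ w) <= des (u ++ w) + size v)%N.
Proof.
elim: v => [|x v IHv] /=; first by rewrite addn0 leqnn.
by have := des_insert u x (v ++ w); lia.
Qed.

Lemma des_from_drop i w : des_from i.+1 w = des (drop i w).
Proof.
elim: i w => [|i IHi] [|x w] //.
  rewrite drop0 /des_from /des -[RHS]count_predT; apply: eq_in_count => j.
  by rewrite mem_filter mem_iota => /and3P[].
by rewrite -IHi /des_from descents_cons count_cat count_nseq count_map.
Qed.

Lemma maj_sum_des_drop w : maj w = (\sum_(0 <= i < size w) des (drop i w))%N.
Proof.
elim: w => [|x w IHw]; first by rewrite /maj !big_nil.
by rewrite maj_cons big_nat_recl // drop0 IHw addnC.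
Qed.

End DescentCalculus.

Section DeletedPrefixes.
Context {d : Order.disp_t} {T : orderType d}.
Implicit Types (x : T) (p a sigma pi alpha : seq T) (i : nat).

Lemma del_prefix0 p a : del_prefix p a 0 = a.
Proof. by rewrite /del_prefix take0; apply/all_filterP/allP. Qed.

Lemma del_prefix_cons x p a i :
  del_prefix (x :: p) a i.+1 = del_prefix p [seq y <- a | y != x] i.
Proof.
rewrite /del_prefix -filter_predI; apply: eq_filter => y.
by rewrite /= inE negb_or andbC.
Qed.

Lemma del_prefix_shuffle sigma pi alpha :
    uniq sigma -> uniq pi -> (forall x, x \in sigma -> x \notin pi) ->
    is_shuffle sigma pi alpha ->
  del_prefix pi alpha (size pi) = sigma.
Proof.
move=> uniq_sigma uniq_pi disj.
move=> /and4P[uniq_alpha /eqP size_alpha sub_sigma sub_pi].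
have [|||_ mem_alpha] := @uniq_min_size _ (sigma ++ pi) alpha.
- rewrite cat_uniq uniq_sigma uniq_pi andbT; apply/hasPn => x x_pi.
  by apply/negP => /disj; rewrite x_pi.
- by move=> x; rewrite mem_cat => /orP[]; apply: mem_subseq.
- by rewrite size_alpha size_cat.
rewrite [RHS](subseq_uniqP uniq_alpha sub_sigma) /del_prefix take_size.
apply: eq_in_filter => x; rewrite -mem_alpha mem_cat.
by have [/disj ->|_ /= ->] := boolP (x \in sigma).
Qed.

Lemma Phi_tS p a i :
  Phi_t p a i.+1 = (maj (del_prefix p a i))%:Z - (maj (del_prefix p a i.+1))%:Z
                   - (des (drop i p))%:Z.
Proof. by rewrite /Phi_t des_from_drop. Qed.

Lemma sum_Phi p a :
  \sum_(x <- (Phi p a).1) x + \sum_(x <- (Phi p a).2) x =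
  (maj a)%:Z - (maj (del_prefix p a (size p)))%:Z - (maj p)%:Z.
Proof.
rewrite /= !big_map big_rev !big_filter -(bigID (drops_des p a) xpredT) /=.
have -> : iota 1 (size p) = index_iota 1 (size p).+1.
  by rewrite /index_iota subn1.
rewrite big_add1 /=.
under eq_bigr do rewrite Phi_tS.
rewrite sumrB (maj_sum_des_drop p) (big_morph Posz PoszD (erefl 0%:Z)).
rewrite (telescope_sumr_eq (fun i => - (maj (del_prefix p a i))%:Z)) //.
  by rewrite del_prefix0 opprK [- _ + _]addrC.
by move=> i _; rewrite opprK addrC.
Qed.

End DeletedPrefixes.

Section Blocks.
Variable T : Type.
Implicit Types (u : seq T) (bs : seq (T * seq T)) (i : nat).

(* A word containing pi as a subword is cut as u ++ block_word bs: each block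
   consists of a letter of pi and of the letters between it and the next one. *)
Definition block_word bs : seq T := flatten [seq b.1 :: b.2 | b <- bs].

(* In the word u ++ block_word bs, the letters outside of pi that precede the
   letter of pi heading block number i (counted from 0). *)
Definition lead_word u bs i : seq T := u ++ flatten (unzip2 (take i bs)).

Lemma next_block u bs i : (i < size bs)%N ->
  exists x v, drop i bs = (x, v) :: drop i.+1 bs
           /\ lead_word u bs i.+1 = lead_word u bs i ++ v.
Proof.
move=> i_lt; rewrite /lead_word -[i.+1]add1n -drop_drop addnC takeD.
case def_drop: (drop i bs) => [|[x v] bs'].
  by move: i_lt; rewrite -subn_gt0 -size_drop def_drop.
exists x, v; rewrite /= drop0 take0; split=> //.
by rewrite /unzip2 map_cat flatten_cat /= cats0 catA.
Qed.

End Blocks.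

Lemma subseq_blocks (T : eqType) (p a : seq T) :
  subseq p a -> exists u bs, a = u ++ block_word bs /\ p = unzip1 bs.
Proof.
elim: a p => [|y a IHa] [|x p]; try by exists [::], [::].
  by exists (y :: a), [::]; rewrite cats0.
rewrite /=; case: eqP => [->|_] /IHa [u [bs [-> pE]]].
  by exists [::], ((y, u) :: bs); rewrite /= pE.
by exists (y :: u), bs.
Qed.

Lemma filter_neq_uniq (T : eqType) (u w : seq T) x :
  uniq (u ++ x :: w) -> [seq y <- u ++ x :: w | y != x] = u ++ w.
Proof.
rewrite uniq_catC /= mem_cat => /andP[/norP[x_notin_w x_notin_u] _].
rewrite filter_cat /= eqxx -filter_cat; apply/all_filterP/allP => y.
by apply: contraTneq => ->; rewrite mem_cat negb_or x_notin_u.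
Qed.

Section DescentExcess.
Context {d : Order.disp_t} {T : orderType d}.
Implicit Types (u : seq T) (b : T * seq T) (bs : seq (T * seq T)) (i : nat).

Lemma del_prefix_blocks u bs i : uniq (u ++ block_word bs) ->
  del_prefix (unzip1 bs) (u ++ block_word bs) i =
  lead_word u bs i ++ block_word (drop i bs).
Proof.
elim: bs u i => [|[x v] bs IHbs] u i uniq_a.
  by rewrite /lead_word !cats0; exact: (del_prefix0 [::] u).
case: i => [|i]; first by rewrite del_prefix0 /lead_word cats0.
have delE := filter_neq_uniq uniq_a.
by rewrite del_prefix_cons delE catA IHbs -?catA -?delE ?filter_uniq.
Qed.

Definition des_excess bs : int :=
  (des (block_word bs))%:Z - (des (unzip1 bs))%:Z.

(* block_word bs and unzip1 bs start with the same letter, so putting b.1 in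
   front of both keeps the excess; only inserting b.2 changes it. *)
Lemma des_excess_cons b bs :
  des_excess bs <= des_excess (b :: bs) <= des_excess bs + (size b.2)%:Z.
Proof.
case: b => x v; rewrite /des_excess /=.
have := des_insert_word [:: x] v (block_word bs); rewrite /= !(des_cons x).
by case: bs => [|[y w] bs] /=; lia.
Qed.

Lemma des_excess_drop u bs i :
  des_excess (drop i.+1 bs) <= des_excess (drop i bs) <=
  des_excess (drop i.+1 bs) + (size (lead_word u bs i.+1))%:Z
                            - (size (lead_word u bs i))%:Z.
Proof.
have [le_size_i|/(next_block u)[x [v [-> ->]]]] := leqP (size bs) i.
  by rewrite /lead_word !drop_oversize ?take_oversize //; lia.
by have := des_excess_cons (x, v) (drop i.+1 bs); rewrite size_cat /=; lia.
Qed.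

Lemma des_excess_drop_noninc bs :
  {homo (fun i => des_excess (drop i bs)) : i j / (i <= j)%N >-> j <= i}.
Proof.
apply: homo_leq => [//|y x z xy yz|i]; first exact: le_trans xy.
by case/andP: (des_excess_drop [::] bs i).
Qed.

Lemma des_excess_lead_nondec u bs :
  {homo (fun i => des_excess (drop i bs) + (size (lead_word u bs i))%:Z)
     : i j / (i <= j)%N >-> i <= j}.
Proof.
apply: homo_leq => [//|y x z|i]; first exact: le_trans.
by have := des_excess_drop u bs i; lia.
Qed.

End DescentExcess.

Section PhiBlocks.
Context {d : Order.disp_t} {T : orderType d}.
Variables (u : seq T) (bs : seq (T * seq T)).
Hypothesis uniq_blocks : uniq (u ++ block_word bs).

Local Notation p := (unzip1 bs).
Local Notation a := (u ++ block_word bs).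
Local Notation sigma := (del_prefix p a (size p)).
(* With i counted from 0, these are f_(i+1) and the word counted by p_(i+1); the
   last index i = n gives 0 and sigma. *)
Local Notation excess i := (des_excess (drop i bs)).
Local Notation lead i := (lead_word u bs i).

Lemma del_prefix_next i : (i < size p)%N ->
  exists x w, [/\ block_word (drop i bs) = x :: w,
    del_prefix p a i = lead i ++ x :: w & del_prefix p a i.+1 = lead i ++ w].
Proof.
rewrite size_map => /(next_block u)[x [v [dropE leadE]]].
exists x, (v ++ block_word (drop i.+1 bs)).
by rewrite !del_prefix_blocks // leadE dropE -catA.
Qed.

Lemma des_del_prefix i : (i < size p)%N ->
  des (del_prefix p a i) = (drops_des p a i.+1 + des (del_prefix p a i.+1))%N.
Proof.
move=> /del_prefix_next[x [w [_]]]; rewrite /drops_des /= => -> ->.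
by have := des_insert (lead i) x w; lia.
Qed.

Lemma Phi_t_excess i : (i < size p)%N ->
  Phi_t p a i.+1 = excess i + (drops_des p a i.+1 * size (lead i))%N%:Z.
Proof.
move=> i_lt; have := des_del_prefix i_lt.
rewrite Phi_tS -map_drop /des_excess -/(unzip1 _).
have [x [w [-> -> ->]]] := del_prefix_next i_lt => desE.
by rewrite maj_insert desE addnK; lia.
Qed.

Lemma size_filter_drops_des i : (i <= size p)%N ->
  (size [seq j <- iota 1 i | drops_des p a j] + des (del_prefix p a i))%N
  = des a.
Proof.
elim: i => [|i IHi] i_le; first by rewrite del_prefix0.
rewrite -(IHi (ltnW i_le)) (des_del_prefix i_le) -[i.+1]addn1 iotaD filter_cat.
by rewrite size_cat /= add1n addn1 -addnA; case: drops_des.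
Qed.

Lemma des_diff_bounds :
  excess 0 <= (des a)%:Z - (des p)%:Z <= excess 0 + (size (lead 0))%:Z.
Proof.
rewrite /lead_word take0 cats0 drop0 /des_excess.
by have := des_insert_word [::] u (block_word bs); rewrite /=; lia.
Qed.

Lemma excess_bounds i : (i <= size p)%N ->
  0 <= excess i <= (des a)%:Z - (des p)%:Z.
Proof.
move=> i_le; have /andP[excess0_le _] := des_diff_bounds.
rewrite (le_trans _ excess0_le) ?des_excess_drop_noninc // andbT.
move: i_le; rewrite size_map => /(des_excess_drop_noninc bs).
by rewrite drop_size.
Qed.

Lemma excess_lead_bounds i : (i <= size p)%N ->
  (des a)%:Z - (des p)%:Z <= excess i + (size (lead i))%:Z <= (size sigma)%:Z.
Proof.
move=> i_le; have /andP[_ le_excess_lead0] := des_diff_bounds.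
rewrite (le_trans le_excess_lead0) ?des_excess_lead_nondec //=.
move: i_le; rewrite del_prefix_blocks // size_map drop_size cats0.
by move=> /(des_excess_lead_nondec u bs); rewrite drop_size add0r.
Qed.

Lemma Phi_lambda_Pseq :
  (Phi p a).1 \in Pseq ((des a)%:Z - (des sigma)%:Z)
                       ((des a)%:Z - (des p)%:Z) (size sigma)%:Z.
Proof.
rewrite inE /= size_map size_rev map_rev rev_sorted all_rev; apply/and3P; split.
- by have := size_filter_drops_des (leqnn (size p)); lia.
- apply: sorted_map_filter_iota => i j /andP[le_ij j_lt] drops_i drops_j.
  rewrite !Phi_t_excess ?(leq_ltn_trans le_ij) // drops_i drops_j !mul1n.
  exact: des_excess_lead_nondec.
apply: all_map_filter_iota => i i_lt drops_i.
by rewrite Phi_t_excess // drops_i mul1n excess_lead_bounds // ltnW.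
Qed.

Lemma Phi_mu_Pseq_le :
  (Phi p a).2 \in Pseq_le ((size p)%:Z - (des a)%:Z + (des sigma)%:Z)
                          ((des a)%:Z - (des p)%:Z).
Proof.
rewrite inE /= size_map; apply/and3P; split.
- have := size_filter_drops_des (leqnn (size p)).
  have : (size [seq i <- iota 1 (size p) | drops_des p a i] +
          size [seq i <- iota 1 (size p) | ~~ drops_des p a i])%N = size p.
    by rewrite !size_filter count_predC size_iota.
  by lia.
- apply: (sorted_map_filter_iota (P := predC (drops_des p a))) => i j.
  move=> /andP[le_ij j_lt] /negPf stays_i /negPf stays_j.
  rewrite !Phi_t_excess ?(leq_ltn_trans le_ij) // stays_i stays_j !addr0.
  exact: des_excess_drop_noninc.
apply: (all_map_filter_iota (P := predC (drops_des p a))) => i i_lt.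
move=> /negPf stays_i.
by rewrite Phi_t_excess // stays_i addr0 excess_bounds // ltnW.
Qed.

End PhiBlocks.

Theorem lemma3p5 (d : Order.disp_t) (T : orderType d) (m n r s k : nat)
    (sigma pi alpha : seq T) (lambda mu : seq int)
    (sigma_perm : uniq sigma) (sigma_size : size sigma = m)
    (sigma_des : des sigma = r)
    (pi_perm : uniq pi) (pi_size : size pi = n) (pi_des : des pi = s)
    (sigma_pi_disjoint : forall x : T, x \in sigma -> x \notin pi)
    (alpha_shuffle : is_shuffle sigma pi alpha) (alpha_des : des alpha = k)
    (Phi_alpha : Phi pi alpha = (lambda, mu)) :
  [/\ lambda \in Pseq (k%:Z - r%:Z) (k%:Z - s%:Z) m%:Z,
      mu \in Pseq_le (n%:Z - k%:Z + r%:Z) (k%:Z - s%:Z)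
    & (maj alpha)%:Z =
      (\sum_(x <- lambda) x) + (\sum_(x <- mu) x) + (maj sigma)%:Z + (maj pi)%:Z].
Proof.
have [uniq_alpha _ _ pi_sub] := and4P alpha_shuffle.
have sigmaE :=
  del_prefix_shuffle sigma_perm pi_perm sigma_pi_disjoint alpha_shuffle.
have [u [bs [alphaE piE]]] := subseq_blocks pi_sub.
rewrite -alpha_des -pi_des -pi_size -sigma_des -sigma_size -sigmaE.
have [-> ->] : lambda = (Phi pi alpha).1 /\ mu = (Phi pi alpha).2.
  by rewrite Phi_alpha.
rewrite alphaE piE in uniq_alpha *.
split; last by rewrite sum_Phi; lia.
  exact: Phi_lambda_Pseq.
exact: Phi_mu_Pseq_le.
Qed.
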